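(* Let $X=\{X_t\}_{t\ge 0}$ be a reversible Markov chain with finite state space $S$ of size $n$, and let $\pi$ be the stationary distribution of $X$. Consider any two states $x,y\in S$. For all integers $t>0$, $$\mathbf{P}_x(\tau(y)=t)\le\frac{2e\cdot\max\left(1,\log\frac{1}{\pi(x)}\right)}{t}.$$ In particular, if $X$ is the random walk on a simple graph with $n\ge 2$ vertices, then for all vertices $x,y$ and all integers $t>0$, $$\mathbf{P}_x(\tau(y)=t)\le\frac{4e\cdot\log n}{t}\qquad\text{and}\qquad\mathbf{P}_x(\mathcal{S}_t)\le\frac{4e\cdot n\log n}{t}.$$
   Context: Markov chains are in discrete time and time-homogeneous, with transition probabilities $p(\cdot,\cdot)$. Reversible with stationary distribution $\pi$ means $\pi(a)p(a,b)=\pi(b)p(b,a)$ for all $a,b\in S$; if $\pi(x)=0$ the right-hand side is read as $+\infty$. $\mathbf{P}_x$ denotes the probability for the chain started at $X_0=x$. The hitting time is $\tau(y)=\min\{t\ge 0: X_t=y\}$ ($\infty$ if $y$ is never reached). $\mathcal{S}_t=\bigcup_{y\in S}\{\tau(y)=t\}$ is the event that the state visited at time $t$ was not visited at any earlier time. $\log$ is the natural logarithm. The random walk on a graph moves at each step to a uniformly random neighbor of the current vertex; the graph is understood to have no isolated vertices, so that the walk is well defined. *)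

(* Defs.v *)
From HB Require Import structures.
From mathcomp Require Import all_boot all_order all_algebra.
From mathcomp Require Import all_classical all_reals all_analysis.
Set Implicit Arguments.
Unset Strict Implicit.
Unset Printing Implicit Defensive.
Import Order.TTheory GRing.Theory Num.Theory.
Local Open Scope classical_set_scope.
Local Open Scope ring_scope.

Definition stochastic (R : realType) (S : finType) (p : S -> S -> R) : Prop :=
  (forall a b, 0 <= p a b) /\ (forall a, \sum_(b : S) p a b = 1).

Definition prob_distribution (R : realType) (S : finType) (pi : S -> R) : Prop :=
  (forall a, 0 <= pi a) /\ \sum_(a : S) pi a = 1.

Definition stationary (R : realType) (S : finType) (p : S -> S -> R)
    (pi : S -> R) : Prop :=
  prob_distribution pi /\ forall b, \sum_(a : S) pi a * p a b = pi b.

Definition detailed_balance (R : realType) (S : finType) (p : S -> S -> R)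
    (pi : S -> R) : Prop :=
  forall a b, pi a * p a b = pi b * p b a.

Definition reversible (R : realType) (S : finType) (p : S -> S -> R)
    (pi : S -> R) : Prop :=
  stationary p pi /\ detailed_balance p pi.

(* The stationarity component of [reversible] is redundant. *)
Lemma detailed_balance_stationary (R : realType) (S : finType)
    (p : S -> S -> R) (pi : S -> R) :
  stochastic p -> prob_distribution pi -> detailed_balance p pi ->
  stationary p pi.
Proof.
move=> [_ p1] pi_distr rev; split=> // b.
by under eq_bigr do rewrite rev; rewrite -mulr_sumr p1 mulr1.
Qed.

(* The Markov property is written without division:
   P(X_0 = s_0, ..., X_{t+1} = s_{t+1})
     = P(X_0 = s_0, ..., X_t = s_t) p(s_t, s_{t+1}),
   so that histories of probability zero need no special treatment. Under
   this predicate, P plays the role of P_x. *)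
Record markov_chain_from (R : realType) (d : measure_display)
    (T : measurableType d) (P : probability T R) (S : finType)
    (p : S -> S -> R) (x : S) (X : nat -> T -> S) : Prop := MarkovChainFrom {
  mc_measurable : forall t s, measurable (X t @^-1` [set s]) ;
  mc_stochastic : stochastic p ;
  mc_start : P [set w | X 0%N w = x] = 1%E ;
  mc_markov : forall (t : nat) (s : nat -> S),
    P [set w | forall i, (i <= t.+1)%N -> X i w = s i] =
    (P [set w | forall i, (i <= t)%N -> X i w = s i] * (p (s t) (s t.+1))%:E)%E
}.

(* [None] stands for the value infinity. *)
Definition hitting_time (T : Type) (S : finType) (X : nat -> T -> S) (y : S)
    (w : T) : option nat :=
  match pselect (exists t, X t w == y) with
  | left visited => Some (ex_minn visited)
  | right _ => None
  end.

Definition hits_at (T : Type) (S : finType) (X : nat -> T -> S) (y : S)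
    (t : nat) : set T :=
  [set w | hitting_time X y w = Some t].

Definition surprise (T : Type) (S : finType) (X : nat -> T -> S) (t : nat) :
    set T :=
  \bigcup_(y in [set: S]) hits_at X y t.

Definition simple_graph (V : finType) (e : rel V) : Prop :=
  symmetric e /\ irreflexive e.

Definition no_isolated_vertex (V : finType) (e : rel V) : Prop :=
  forall u, exists v, e u v.

Definition degree (V : finType) (e : rel V) (u : V) : nat := #|[set v | e u v]%SET|.

Definition random_walk (R : realType) (V : finType) (e : rel V) (u v : V) : R :=
  if e u v then (degree e u)%:R^-1 else 0.

(* Main.v *)
Require Import Defs.
From HB Require Import structures.
From mathcomp Require Import all_boot all_order all_algebra.
From mathcomp Require Import all_classical all_reals all_analysis.
From mathcomp Require Import ring lra.
Import Order.TTheory GRing.Theory Num.Theory.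
Local Open Scope classical_set_scope.
Local Open Scope ring_scope.

(* Write u_t(z) = P_z(tau(y) = t) and let P be the transition operator. Dropping
   the constraint of avoiding y gives u_t <= P^(2k) u_(t-2k), so that
     (t/2) pi(x) u_t(x) <= sum_(k <= t/2) <1_x, P^(2k) u_(t-2k)>_pi
                         = sum_(k <= t/2) <P^k 1_x, P^k u_(t-2k)>_pi
   by reversibility. Since sum_k u_(t-2k) <= 1, the right-hand side is at most
   the expected maximum of the martingale P^k 1_x(X_k), read in decreasing k, of
   the stationary chain (as in Starr's maximal inequality). Its values lie in
   [0, 1] and its mean is pi(x), so Doob's inequality gives
   pi(x) (1 + log (1 / pi(x))). *)

(** * Transition operator and first-visit probabilities *)

Definition transition {R : realType} {S : finType} (p : S -> S -> R)
    (f : S -> R) : S -> R :=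
  fun a => \sum_(b : S) p a b * f b.

(** This is $u_t(z)$, computed by conditioning on the first step; at [z = y] it vanishes for
    positive times, since [y] is already hit at time 0. *)
Fixpoint first_visit {R : realType} {S : finType} (p : S -> S -> R) (y : S)
    (t : nat) (z : S) : R :=
  match t with
  | 0%N => (z == y)%:R
  | t'.+1 => if z == y then 0 else transition p (first_visit p y t') z
  end.

(* The function [N - M * ln N] bounds the expected final running maximum of a
   martingale with values in [0, 1], given its present value [M] and the past
   maximum [N]. *)
Lemma max_sub_mul_ln {R : realType} (M N : R) : 0 <= M <= 1 -> 0 < N <= 1 ->
  Num.max N M - M * ln (Num.max N M) <= N - M * ln N.
Proof.
move=> /andP[M0 M1] /andP[N0 N1]; case: (leP M N) => // NM.
have M_gt0 := lt_trans N0 NM.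
(* Multiplied by [M], the inequality $\log u \le u - 1$ at [u = N / M] is the claim. *)
have : ln (1 + (N / M - 1)) <= N / M - 1.
  by apply: le_ln1Dx; rewrite ltrBrDl subrr divr_gt0.
rewrite addrC subrK ln_div ?posrE // -(ler_pM2l M_gt0) !mulrBr mulr1 mulrCA.
by rewrite mulfV ?gt_eqF // mulr1; lra.
Qed.

Section Transition.
Context {R : realType} {S : finType} {p : S -> S -> R}.
Hypothesis p_stoch : stochastic p.
Implicit Types f g : S -> R.

Local Notation P := (transition p).

Lemma iter_transition_le n f g :
  (forall a, f a <= g a) -> forall a, iter n P f a <= iter n P g a.
Proof.
move=> fg; elim: n => [//|n IH] a /=.
by apply: ler_sum => b _; apply: ler_wpM2l => //; case: p_stoch.
Qed.

Lemma iter_transitionD n f g :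
  iter n P (fun a => f a + g a) = fun a => iter n P f a + iter n P g a.
Proof.
elim: n => [//|n IH]; rewrite !iterS IH; apply/funext => a.
by rewrite /transition -big_split; apply: eq_bigr => b _; rewrite mulrDr.
Qed.

Lemma iter_transition_cst n (c : R) a : iter n P (fun=> c) a = c.
Proof.
elim: n a => [//|n IH] a /=; rewrite /transition.
under eq_bigr do rewrite IH.
by rewrite -mulr_suml; case: p_stoch => _ ->; rewrite mul1r.
Qed.

Lemma iter_transition_ge0 n f :
  (forall a, 0 <= f a) -> forall a, 0 <= iter n P f a.
Proof.
by move=> f0 a; rewrite -(iter_transition_cst n 0 a); apply: iter_transition_le.
Qed.

Lemma first_visit_ge0 y t z : 0 <= first_visit p y t z.
Proof.
elim: t z => [z|t IH z] /=; first exact: ler0n.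
by case: ifP => // _; exact: (iter_transition_ge0 1).
Qed.

Lemma first_visit_le_iter y t s z :
  first_visit p y (t + s) z <= iter t P (first_visit p y s) z.
Proof.
elim: t z => [//|t IH] z; rewrite addSn /=.
have le : transition p (first_visit p y (t + s)) z <=
    transition p (iter t P (first_visit p y s)) z.
  exact: (iter_transition_le 1).
case: ifP => // _; apply: le_trans le.
by apply: (iter_transition_ge0 1) => b; exact: first_visit_ge0.
Qed.

Lemma sum_first_visit_le1 y t z : \sum_(s < t) first_visit p y s z <= 1.
Proof.
elim: t z => [|t IH] z; first by rewrite big_ord0 ler01.
rewrite big_ord_recl /=; have [_|_] := eqVneq z y.
  by rewrite big1 // addr0.
rewrite add0r /transition exchange_big /=.
rewrite -[leRHS](iter_transition_cst 1 1 z) /=.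
apply: ler_sum => b _; rewrite -mulr_sumr; apply: ler_wpM2l => //.
by case: p_stoch.
Qed.

(** The times [t - k.*2] are distinct and lie in $[0, t]$, so this is part of the full sum of
    first-visit probabilities; each induction step removes two times. *)
Lemma sum_first_visit_double y t (m : nat) z : (m.*2 <= t)%N ->
  \sum_(k < m.+1) first_visit p y (t - k.*2) z <= 1.
Proof.
move=> mt; apply: le_trans (sum_first_visit_le1 y t.+1 z).
elim: m t mt => [|m IH] t mt.
  rewrite big_ord1 subn0 big_ord_recr lerDr sumr_ge0 // => s _.
  exact: first_visit_ge0.
case: t mt => [|[|t]] //; rewrite doubleS !ltnS => mt.
rewrite big_ord_recl subn0 [leRHS]big_ord_recr [X in _ <= X + _]big_ord_recr.
rewrite [leLHS]addrC lerD2r.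
under eq_bigr do rewrite lift0 doubleS !subSS.
by rewrite ler_wpDr ?IH ?first_visit_ge0.
Qed.

(** * Maximal inequality *)

(* In closed form, [paired f phi j = \sum_(k <= j) P^(j-k) (P^k f * P^k phi_k)]:
   run the chain from time [j] down to time [0], and at each time [k] collect
   the martingale value [P^k f] weighted by the conditional expectation of
   [phi_k] at the final state. *)
Fixpoint paired (f : S -> R) (phi : nat -> S -> R) (j : nat) : S -> R :=
  match j with
  | 0%N => fun a => f a * phi 0%N a
  | j'.+1 => fun a => P (paired f phi j') a + iter j P f a * iter j P (phi j) a
  end.

(* Maximal inequality in one induction on [m], with [N] as running maximum;
   no path space is needed because the bound is kept for all [N] and [a]. *)
Lemma paired_le f (phi : nat -> S -> R) (m : nat) (N : R) a :
  (forall a, 0 <= f a <= 1) -> (forall k a, 0 <= phi k a) ->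
  (forall a, \sum_(k < m.+1) phi k a <= 1) -> 0 < N <= 1 ->
  paired f phi m a + N * iter m P (fun b => 1 - \sum_(k < m.+1) phi k b) a <=
  N - iter m P f a * ln N.
Proof.
move=> f01 phi0; elim: m N a => [|m IH] N a phi1 N01.
  rewrite /= big_ord1; set N' := Num.max N (f a).
  have [_ f1] := andP (f01 a); have [N0 N1] := andP N01.
  have := max_sub_mul_ln (f a) N (f01 a) N01; rewrite -/N'.
  have NN' : N <= N' by rewrite le_max lexx.
  have fN' : f a <= N' by rewrite le_max lexx orbT.
  (* Since [N' <= 1], the bound [N' - f a * ln N'] is at least [N'], which dominates both [f a] and
     [N]. *)
  have : f a * ln N' <= 0.
    by rewrite mulr_ge0_le0 ?ln_le0 ?ge_max ?N1 //; case/andP: (f01 a).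
  have := phi1 a; rewrite big_ord1 => p1; have p0 := phi0 0%N a.
  have : f a * phi 0%N a <= N' * phi 0%N a by rewrite ler_wpM2r.
  have : N * (1 - phi 0%N a) <= N' * (1 - phi 0%N a).
    by rewrite ler_wpM2r // subr_ge0.
  lra.
set M := iter m.+1 P f a; set N' := Num.max N M.
have M01 : 0 <= M <= 1.
  rewrite iter_transition_ge0 => [|b]; last by case/andP: (f01 b).
  rewrite -(iter_transition_cst m.+1 1 a); apply: iter_transition_le => b.
  by case/andP: (f01 b).
have [N0 N1] := andP N01.
apply: le_trans (max_sub_mul_ln M N M01 N01); rewrite -/N'.
have N'01 : 0 < N' <= 1.
  by rewrite lt_max N0 ge_max N1; case/andP: M01.
have phi1' b : \sum_(k < m.+1) phi k b <= 1.
  by apply: le_trans (phi1 b); rewrite [leRHS]big_ord_recr lerDl.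
set A := iter m.+1 P (phi m.+1) a.
set B := iter m.+1 P (fun b => 1 - \sum_(k < m.+2) phi k b) a.
have A0 : 0 <= A by exact: iter_transition_ge0.
have B0 : 0 <= B by apply: iter_transition_ge0 => b; rewrite subr_ge0.
(* The weight [A] collected at time [m.+1] and the leftover [B] add up to the averaged leftover of
   the induction hypothesis; both are charged to the new maximum [N']. *)
have AB : A + B = iter m.+1 P (fun b => 1 - \sum_(k < m.+1) phi k b) a.
  rewrite /A /B -[LHS](congr1 (@^~ a) (iter_transitionD _ _ _)).
  congr (iter _ _ _ a); apply/funext => b; rewrite big_ord_recr /=.
  by ring.
have MA : M * A <= N' * A by rewrite ler_wpM2r // le_max lexx orbT.
have NB : N * B <= N' * B by rewrite ler_wpM2r // le_max lexx.
have : P (paired f phi m) a + N' * (A + B) <= N' - M * ln N'.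
  rewrite AB /M !iterS /transition mulr_sumr -big_split /=.
  rewrite mulr_suml -{2}[N'](iter_transition_cst 1 _ a) /= /transition -sumrB.
  apply: ler_sum => b _.
  rewrite mulrCA -mulrDr -mulrA -mulrBr ler_wpM2l //; first by case: p_stoch.
  exact: IH.
have -> : paired f phi m.+1 a = P (paired f phi m) a + M * A by [].
lra.
Qed.

(** * Reversibility and the bound on first-visit probabilities *)

Lemma iter_transition_adjoint (pi : S -> R) n f g : detailed_balance p pi ->
  \sum_a pi a * iter n P f a * g a = \sum_a pi a * f a * iter n P g a.
Proof.
move=> rev; elim: n f g => [//|n IH] f g.
rewrite iterSr IH iterS /transition.
under eq_bigr do rewrite mulr_sumr mulr_suml.
rewrite exchange_big /=; apply: eq_bigr => b _; rewrite mulr_sumr.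
by apply: eq_bigr => a _; rewrite !mulrA rev; ring.
Qed.

Lemma stationary_iter (pi : S -> R) n f : stationary p pi ->
  \sum_a pi a * iter n P f a = \sum_a pi a * f a.
Proof.
move=> [_ stat]; elim: n => [//|n <-]; rewrite iterS /transition.
under eq_bigr do rewrite mulr_sumr.
rewrite exchange_big /=; apply: eq_bigr => b _; rewrite -[in RHS]stat mulr_suml.
by apply: eq_bigr => a _; rewrite mulrA.
Qed.

(** Stationarity removes the outer [P] in the recursion of [paired]; self-adjointness in $L^2(\pi)$
    then moves $P^k$ from [f] to [phi k]. *)
Lemma sum_paired (pi : S -> R) f (phi : nat -> S -> R) (m : nat) :
  reversible p pi ->
  \sum_a pi a * paired f phi m a =
  \sum_(k < m.+1) \sum_a pi a * f a * iter k P (iter k P (phi k)) a.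
Proof.
move=> [stat rev]; elim: m => [|m IH].
  by rewrite big_ord1; apply: eq_bigr => a _; rewrite mulrA.
rewrite big_ord_recr /= -IH.
under eq_bigr do rewrite mulrDr mulrA.
rewrite big_split /= (stationary_iter pi 1 _ stat).
by rewrite (iter_transition_adjoint pi m.+1 f _ rev).
Qed.

Lemma reversible_first_visit_le (pi : S -> R) x y t :
  reversible p pi -> 0 < pi x ->
  t%:R * first_visit p y t x <= 2 * (1 - ln (pi x)).
Proof.
move=> rev pix_gt0; have [[[pi0 pi1] _] _] := rev.
have pix_le1 : pi x <= 1.
  by rewrite -pi1 (bigD1 x) //= lerDl sumr_ge0.
pose f a : R := (a == x)%:R.
pose phi k := first_visit p y (t - k.*2).
pose m := t./2.
have mt : (m.*2 <= t)%N by rewrite -[leqRHS]odd_double_half leq_addl.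
have phi1 a : \sum_(k < m.+1) phi k a <= 1 by exact: sum_first_visit_double.
have f01 a : 0 <= f a <= 1 by rewrite /f; case: eqP; rewrite !lexx ler01.
have sum_f (g : S -> R) : \sum_a pi a * f a * g a = pi x * g x.
  rewrite (bigD1 x) //= big1 ?addr0 /f ?eqxx ?mulr1 // => a /negPf ->.
  by rewrite mulr0 mul0r.
have upper : \sum_a pi a * paired f phi m a <= pi x * (1 - ln (pi x)).
  have -> : pi x * (1 - ln (pi x)) =
      \sum_a pi a * (pi x - iter m P f a * ln (pi x)).
    under eq_bigr do rewrite mulrBr mulrA.
    rewrite sumrB -!mulr_suml pi1 mul1r (stationary_iter pi m f rev.1).
    under eq_bigr do rewrite -[_ * f _]mulr1.
    by rewrite sum_f mulr1 mulrBr mulr1.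
  apply: ler_sum => a _; apply: ler_wpM2l => //.
  (* The initial level [N = pi x] minimises [N - pi x * ln N], the $\pi$-average of the bound. *)
  have := paired_le f phi m (pi x) a f01.
  move=> /(_ (fun k => first_visit_ge0 y _) phi1); rewrite pix_gt0 pix_le1.
  move=> /(_ isT); apply: le_trans; rewrite lerDl mulr_ge0 //.
  by apply: iter_transition_ge0 => b; rewrite subr_ge0.
have lower : m.+1%:R * (pi x * first_visit p y t x) <=
    \sum_a pi a * paired f phi m a.
  rewrite sum_paired // mulr_natl -[m.+1 in leLHS]card_ord -sumr_const.
  apply: ler_sum => k _; rewrite sum_f ler_wpM2l // -iterD addnn.
  have kt : (k.*2 <= t)%N.
    by apply: leq_trans mt; rewrite leq_double -ltnS.
  by rewrite -{1}(subnKC kt) first_visit_le_iter.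
(* The even lags from 0 to [t] number at least [t / 2]. *)
have tm : t%:R <= 2 * m.+1%:R :> R.
  rewrite -natrM ler_nat mul2n -[leqLHS]odd_double_half doubleS -/m.
  by case: (odd t); rewrite ?add1n ?add0n ?ltnS ?leqW.
have := le_trans lower upper.
rewrite mulrCA ler_pM2l // => h.
have := ler_wpM2r (first_visit_ge0 y t x) tm; lra.
Qed.

End Transition.

(** * Hitting events of the chain *)

Lemma hits_atE (T : Type) (S : finType) (X : nat -> T -> S) (y : S) (t : nat) :
  hits_at X y t = [set w | (forall i, (i < t)%N -> X i w != y) /\ X t w = y].
Proof.
apply/seteqP; split=> w; rewrite /hits_at /hitting_time /=.
  case: pselect => // vis [<-]; case: ex_minnP => m /eqP Xm minm.
  by split=> // i im; apply/negP => /minm; rewrite leqNgt im.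
case=> avoid Xt; case: pselect => [vis|]; last by case; exists t; apply/eqP.
congr Some; case: ex_minnP => m Xm minm; apply/eqP; rewrite eqn_leq.
rewrite minm ?Xt //= leqNgt; apply/negP => /avoid.
by rewrite Xm.
Qed.

Lemma le_measure_bigcup_finType {R : realType} {d : measure_display}
    {T : measurableType d} (mu : {measure set T -> \bar R}) {S : finType}
    (A : set T) (F : S -> set T) :
  measurable A -> (forall v, measurable (F v)) ->
  A `<=` \bigcup_(v in [set: S]) F v -> (mu A <= \sum_(v : S) mu (F v))%E.
Proof.
move=> mA mF AF; rewrite fsbig_seq ?index_enum_uniq //.
rewrite (_ : [set` index_enum S] = setT); last first.
  by apply/seteqP; split=> v //= _; rewrite mem_index_enum.
by apply: content_sub_fsum => //; exact: finite_finset.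
Qed.

Section HittingProbability.
Context {R : realType} {d : measure_display} {T : measurableType d}.
Context {P : probability T R} {S : finType} {p : S -> S -> R} {x : S}.
Context {X : nat -> T -> S}.
Hypothesis mc : markov_chain_from P p x X.

Let cylinder (k : nat) (s : nat -> S) : set T :=
  [set w | forall i, (i <= k)%N -> X i w = s i].

(** A form of [hits_at] fit for induction on [r]: [mc_markov] speaks of full histories, so the path
    up to time [k] is kept, and the wait for [y] starts afresh at time [k]. *)
Let cylinder_hits (k : nat) (s : nat -> S) (y : S) (r : nat) : set T :=
  cylinder k s `&`
  [set w | (forall i, (i < r)%N -> X (k + i)%N w != y) /\ X (k + r)%N w = y].

Let measurable_eq i z : measurable [set w | X i w = z].
Proof. exact: (mc_measurable mc i z). Qed.

Let measurable_avoid k y r :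
  measurable [set w | (forall i, (i < r)%N -> X (k + i)%N w != y) /\
                      X (k + r)%N w = y].
Proof.
apply: measurableI; last exact: measurable_eq.
rewrite [X in measurable X](_ : _ = \bigcap_(i in [set i | (i < r)%N])
    ~` [set w | X (k + i)%N w = y]).
  by apply: bigcap_measurableType => i _; apply/measurableC/measurable_eq.
by apply/seteqP; split=> w h i /h /eqP.
Qed.

Let measurable_cylinder k s : measurable (cylinder k s).
Proof. by apply: bigcap_measurableType => i _; exact: measurable_eq. Qed.

Lemma measurable_hits_at y t : measurable (hits_at X y t).
Proof. by rewrite hits_atE; exact: (measurable_avoid 0). Qed.

Let measurable_cylinder_hits k s y r : measurable (cylinder_hits k s y r).
Proof. exact: measurableI. Qed.

Let prob_cylinder_hits_le k s y r :
  (P (cylinder_hits k s y r) <=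
   P (cylinder k s) * (first_visit p y r (s k))%:E)%E.
Proof.
elim: r k s => [|r IH] k s /=.
  case: eqVneq => [sk|sky].
    by rewrite mule1 le_measure ?inE //; exact: subIsetl.
  rewrite mule0 (_ : cylinder_hits _ _ _ _ = set0) ?measure0 //.
  rewrite -subset0 => w [/(_ k (leqnn k)) + [_]].
  by rewrite addn0 => -> /eqP; rewrite (negPf sky).
case: eqVneq => [sk|sky].
  rewrite mule0 (_ : cylinder_hits _ _ _ _ = set0) ?measure0 //.
  rewrite -subset0 => w [/(_ k (leqnn k)) + [/(_ 0%N isT)]].
  by rewrite addn0 => ->; rewrite sk eqxx.
(* The history is prolonged by [v] at time [k.+1]; later values are immaterial. Subadditivity over
   [v] suffices for an upper bound. *)
pose ext v i := if (i <= k)%N then s i else v.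
have cylinder_ext v : P (cylinder k.+1 (ext v)) =
    (P (cylinder k s) * (p (s k) v)%:E)%E.
  rewrite (mc_markov mc) /ext leqnn ltnn; congr (P _ * _)%E.
  by apply/seteqP; split=> w h i ik; have := h i ik; rewrite ik.
have sub : cylinder_hits k s y r.+1 `<=`
    \bigcup_(v in [set: S]) cylinder_hits k.+1 (ext v) y r.
  move=> w [cyl [avoid hit]]; exists (X k.+1 w) => //; split.
    move=> i; rewrite /ext leq_eqVlt ltnS => /orP[/eqP ->|ik].
      by rewrite ltnn.
    by rewrite ik cyl.
  split; last by rewrite addSnnS.
  by move=> i ir; rewrite addSnnS; exact: avoid.
apply: le_trans (le_measure_bigcup_finType P _ _ _ _ sub) _ => //.
have cyl_fin : P (cylinder k s) \is a fin_num by exact: fin_num_measure.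
rewrite -(fineK cyl_fin) /transition -EFinM mulr_sumr -sumEFin.
apply: lee_sum => v _; apply: le_trans (IH _ _) _.
by rewrite cylinder_ext /ext ltnn -(fineK cyl_fin) -!EFinM mulrA.
Qed.

Lemma prob_hits_at_le y t : (P (hits_at X y t) <= (first_visit p y t x)%:E)%E.
Proof.
pose start : set T := [set w | X 0%N w = x].
have mstart : measurable start by exact: measurable_eq.
have mhits := measurable_hits_at y t.
have -> : P (hits_at X y t) = P (cylinder_hits 0 (fun=> x) y t).
  (* Paths that do not start at [x] have probability zero. *)
  rewrite (measureDI P mhits mstart) -[RHS]add0e; congr (_ + _)%E.
    apply/eqP; rewrite -measure_le0.
    apply: le_trans (_ : P (~` start) <= 0)%E.
      apply: le_measure; rewrite ?inE; last by move=> w [].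
      - exact: measurableD.
      - exact: measurableC.
    by rewrite probability_setC // (mc_start mc) subee.
  congr (P _); rewrite hits_atE setIC; congr (_ `&` _).
  apply/seteqP; split=> w; last by apply.
  by move=> sw i; rewrite leqn0 => /eqP ->.
apply: le_trans (prob_cylinder_hits_le _ _ _ _) _.
apply: gee_pMl; rewrite ?lee_fin ?(first_visit_ge0 (mc_stochastic mc)) //.
- exact: fin_num_measure.
- exact: probability_le1.
Qed.

End HittingProbability.

(** * The bound for reversible chains *)

Lemma expR1_ge2 {R : realType} : 2 <= expR 1 :> R.
Proof. exact: expR_ge1Dx. Qed.

Lemma reversible_hits_at_le {R : realType} {d : measure_display}
    {T : measurableType d} {P : probability T R} {S : finType}
    {p : S -> S -> R} (pi : S -> R) (x y : S) {X : nat -> T -> S} :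
  reversible p pi -> markov_chain_from P p x X ->
  forall t : nat, (0 < t)%N ->
  (P (hits_at X y t) <=
   (2 * expR 1)%:E * maxe 1 (lne ((pi x)%:E^-1)) / t%:R%:E)%E.
Proof.
move=> rev mc t t0; have [[[pi0 _] _] _] := rev.
have t0R : 0 < t%:R :> R by rewrite ltr0n.
rewrite [((t%:R)%:E^-1)%E]inver gt_eqF //.
have [pix0|pix_neq0] := eqVneq (pi x) 0.
  rewrite pix0 inve0 /= maxey gt0_muley ?lte_fin ?mulr_gt0 ?expR_gt0 //.
  by rewrite gt0_mulye ?lte_fin ?invr_gt0 // leey.
have pix_gt0 : 0 < pi x by rewrite lt_neqAle eq_sym pix_neq0 pi0.
rewrite inver (negPf pix_neq0) lneV // lne_EFin // -EFinN -EFin_max -!EFinM.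
apply: le_trans (prob_hits_at_le mc y t) _; rewrite lee_fin ler_pdivlMr //.
have := reversible_first_visit_le (mc_stochastic mc) pi x y t rev pix_gt0.
rewrite mulrC => /le_trans; apply.
set m := Num.max 1 (- ln (pi x)).
have m1 : 1 <= m by rewrite le_max lexx.
have ml : - ln (pi x) <= m by rewrite le_max lexx orbT.
(* With $L = -\log \pi(x)$, the constant comes from $1 + L \le 2\max(1, L) \le e\max(1, L)$. *)
have : 2 * m <= expR 1 * m by rewrite ler_wpM2r ?expR1_ge2 //; lra.
rewrite -mulrA ler_pM2l //; lra.
Qed.

(** * Random walk on a simple graph *)

(** The stationary distribution of the walk; in a simple graph the denominator is twice the number
    of edges. *)
Definition degree_measure (R : realType) {V : finType} (e : rel V)
    (v : V) : R :=
  (degree e v)%:R / (\sum_(u : V) degree e u)%:R.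

Section RandomWalk.
Context {R : realType} {V : finType} {e : rel V}.
Hypothesis e_simple : simple_graph e.
Hypothesis e_no_isolated : no_isolated_vertex e.

Lemma degree_gt0 v : (0 < degree e v)%N.
Proof.
by have [w vw] := e_no_isolated v; apply/card_gt0P; exists w; rewrite inE.
Qed.

Lemma sum_degree_gt0 (v : V) : (0 < \sum_(u : V) degree e u)%N.
Proof. by rewrite (bigD1 v) //= addn_gt0 degree_gt0. Qed.

(** Along an edge both sides of detailed balance are the inverse of the total degree; [v] witnesses
    that this total is positive. *)
Lemma random_walk_reversible (v : V) :
  stochastic (random_walk R e) ->
  reversible (random_walk R e) (degree_measure R e).
Proof.
move=> stoch; suff [distr rev] : prob_distribution (degree_measure R e) /\
    detailed_balance (random_walk R e) (degree_measure R e).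
  by split=> //; exact: detailed_balance_stationary.
split; first split=> [a|].
- by rewrite divr_ge0.
- rewrite -mulr_suml -natr_sum mulfV // pnatr_eq0 -lt0n.
  exact: sum_degree_gt0.
move=> a b; rewrite /degree_measure /random_walk [e b a]e_simple.1.
case: ifP; rewrite ?mulr0 // => _.
by rewrite mulrAC mulfV ?pnatr_eq0 -?lt0n ?degree_gt0 //
  mulrAC mulfV ?pnatr_eq0 -?lt0n ?degree_gt0.
Qed.

(** Degrees are at least 1 and sum to at most $n^2$. Hence $\log(1/\pi(x)) \le 2\log n$, which turns
    $2e$ into $4e$. *)
Lemma degree_measure_ge v : (#|V|%:R ^+ 2)^-1 <= degree_measure R e v.
Proof.
have sum_gt0 := sum_degree_gt0 v.
have n_gt0 : (0 < #|V|)%N by apply/card_gt0P; exists v.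
rewrite -[leLHS]mul1r ler_pM ?ler1n ?degree_gt0 ?invr_ge0 ?exprn_ge0 //.
rewrite lef_pV2 ?posrE ?exprn_gt0 ?ltr0n // -natrX ler_nat.
rewrite -mulnn -sum_nat_const; apply: leq_sum => u _; exact: max_card.
Qed.

End RandomWalk.

Lemma random_walk_hits_at_le {R : realType} {d : measure_display}
    {T : measurableType d} {P : probability T R} {V : finType} {e : rel V}
    {x : V} {X : nat -> T -> V} :
  simple_graph e -> no_isolated_vertex e -> (2 <= #|V|)%N ->
  markov_chain_from P (random_walk R e) x X ->
  forall (y : V) (t : nat), (0 < t)%N ->
  (P (hits_at X y t) <= (4 * expR 1 * ln (#|V|%:R) / t%:R)%:E)%E.
Proof.
move=> e_simple e_niso V2 mc y t t0.
have rev := random_walk_reversible e_simple e_niso x (mc_stochastic mc).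
have n0 : 0 < #|V|%:R :> R by rewrite ltr0n; exact: leq_trans V2.
(* Absorbs the 1 in the maximum: $\log n \ge 1 - 1/n \ge 1/2$ for $n \ge 2$. *)
have ln_ge : 1 <= 2 * ln (#|V|%:R) :> R.
  have : ln (1 + (#|V|%:R^-1 - 1)) <= #|V|%:R^-1 - 1 :> R.
    by apply: le_ln1Dx; rewrite ltrBrDl subrr invr_gt0.
  rewrite addrC subrK lnV ?posrE //.
  have : (#|V|%:R^-1 : R) <= 2^-1.
    by rewrite lef_pV2 ?posrE // ler_nat.
  lra.
have pi_ge := degree_measure_ge e_niso x (R := R).
have pi_gt0 : 0 < degree_measure R e x.
  by apply: lt_le_trans _ pi_ge; rewrite invr_gt0 exprn_gt0.
apply: le_trans (reversible_hits_at_le _ x y rev mc t t0) _.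
rewrite !inver gt_eqF // gt_eqF ?ltr0n // lneV // lne_EFin // -EFinN.
rewrite -EFin_max -!EFinM lee_fin ler_wpM2r ?invr_ge0 //.
have -> : 4 * expR 1 * ln (#|V|%:R) = 2 * expR 1 * (2 * ln (#|V|%:R)) :> R.
  by ring.
rewrite ler_wpM2l ?mulr_ge0 ?expR_ge0 // ge_max ln_ge /=.
have : ln (#|V|%:R ^+ 2)^-1 <= ln (degree_measure R e x) :> R.
  by rewrite ler_ln ?posrE // invr_gt0 exprn_gt0.
rewrite lnV ?posrE ?exprn_gt0 // lnXn // mulr2n; lra.
Qed.

(* In \bar R one has 0^-1 = +oo and lne +oo = +oo, so that the first bound is
   +oo when pi x = 0. *)
Theorem theorem1p2 (R : realType) :
  (forall (d : measure_display) (T : measurableType d) (P : probability T R)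
     (S : finType) (p : S -> S -> R) (pi : S -> R) (x y : S)
     (X : nat -> T -> S),
     reversible p pi ->
     markov_chain_from P p x X ->
     forall t : nat, (0 < t)%N ->
     (P (hits_at X y t) <=
      (2 * expR 1)%:E * maxe 1 (lne ((pi x)%:E^-1)) / t%:R%:E)%E)
  /\
  (forall (d : measure_display) (T : measurableType d) (P : probability T R)
     (V : finType) (e : rel V) (x y : V) (X : nat -> T -> V),
     simple_graph e ->
     no_isolated_vertex e ->
     (2 <= #|V|)%N ->
     markov_chain_from P (random_walk R e) x X ->
     forall t : nat, (0 < t)%N ->
     (P (hits_at X y t) <=
      (4 * expR 1 * ln (#|V|%:R) / t%:R)%:E)%E /\
     (P (surprise X t) <=
      (4 * expR 1 * (#|V|%:R * ln (#|V|%:R)) / t%:R)%:E)%E).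
Proof.
split=> [d T P S p pi x y X rev mc t t0|].
  exact: (reversible_hits_at_le _ x y rev mc t t0).
move=> d T P V e x y X e_simple e_niso V2 mc t t0.
have hits_le := random_walk_hits_at_le e_simple e_niso V2 mc.
split; first exact: hits_le.
have mhits := measurable_hits_at mc.
(* Union bound over the vertex first visited at time [t], at the cost of a factor [#|V|]. *)
apply: le_trans (le_measure_bigcup_finType P _ (hits_at X ^~ t) _ _ _) _.
- by apply: fin_bigcup_measurable => //; exact: finite_finset.
- by move=> z; exact: mhits.
- by [].
apply: le_trans (_ : _ <= \sum_(z : V) (4 * expR 1 * ln #|V|%:R / t%:R)%:E)%E _.
  by apply: lee_sum => z _; exact: hits_le.
rewrite sumEFin lee_fin sumr_const -[leLHS]mulr_natl le_eqVlt.
by apply/orP; left; apply/eqP; ring.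
Qed.
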